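(* For each $n\ge1$ let $L_0^{(n)}$ be a bounded generator of a strongly continuous contraction semigroup $e^{tL_0^{(n)}}$ in $X_n$, and let $W^{(n)}$ be a bounded operator from $X_{n-1}$ into $X_n$ whose norm satisfies $$\|W^{(n)}\|_{X_{n-1}\to X_n}\le Bn(n-1),\qquad n\ge1,$$ for some $B\ge1$ independent of $n$. For $G=(G^{(n)})_{n\ge0}$ define $L_0G$ and $WG$ by $$(L_0G)^{(n)}=L_0^{(n)}G^{(n)}\ (n\ge1),\qquad (WG)^{(n)}=W^{(n)}G^{(n-1)}\ (n\ge2),\qquad (L_0G)^{(0)}=(WG)^{(0)}=(WG)^{(1)}=0 .$$ Let $C>0$ and $G_0\in\mathcal{L}_C$. Then the initial value problem $$\frac{\partial}{\partial t}G_t(\eta)=(L_0G_t)(\eta)+(WG_t)(\eta),\quad t>0,\ \eta\in\Gamma_0,\qquad G_t\big|_{t=0}=G_0,$$ has a unique solution $G_t\in\mathcal{L}_{\rho(t,C)}$, where $$\rho(t,C):=\frac{C}{1+BCt}.$$ Furthermore, $$\|G_t\|_{\mathcal{L}_{\rho(t,C)}}\le\|G_0\|_{\mathcal{L}_C}.$$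
   Context: $d\in\mathbb{N}$; $X_n:=L^1((\mathbb{R}^d)^n,dx_1\cdots dx_n)$ for $n\ge1$, $X_0:=\mathbb{R}$. $\Gamma_0=\bigsqcup_{n\ge0}\Gamma^{(n)}$ is the set of all finite subsets of $\mathbb{R}^d$ ($\Gamma^{(n)}$ the $n$-point subsets, with the Borel structure of the quotient of the off-diagonal part of $(\mathbb{R}^d)^n$ by permutations), with Lebesgue--Poisson measure $\lambda=\sum_{n\ge0}\frac1{n!}m^{(n)}$, $m^{(n)}$ being the image of Lebesgue measure on $\Gamma^{(n)}$ and $m^{(0)}=\delta_{\{\emptyset\}}$. A function $G$ on $\Gamma_0$ is identified with the sequence $(G^{(n)})_{n\ge0}$ of symmetric functions $G^{(n)}(x_1,\dots,x_n)=G(\{x_1,\dots,x_n\})$ on $(\mathbb{R}^d)^n$. For $C>0$, $\mathcal{L}_C:=L^1(\Gamma_0,C^{|\eta|}d\lambda(\eta))$, i.e. $\|G\|_{\mathcal{L}_C}=\sum_{n\ge0}\frac{C^n}{n!}\|G^{(n)}\|_{X_n}$. The operators $L_0^{(n)}$, $W^{(n)}$ map symmetric functions to symmetric functions, so that $L_0G$ and $WG$ are again functions on $\Gamma_0$. The initial value problem is understood as the infinite system $\frac{\partial}{\partial t}G_t^{(n)}=L_0^{(n)}G_t^{(n)}+W^{(n)}G_t^{(n-1)}$ in $X_n$, $n\ge1$, with $G_t^{(0)}=G_0^{(0)}$ and initial data $G_0^{(n)}$. *)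

(* Defs.v *)
From HB Require Import structures.
From mathcomp Require Import all_boot all_order all_algebra perm.
From mathcomp Require Import all_classical all_reals all_analysis measurable_realfun.

Set Implicit Arguments.
Unset Strict Implicit.
Unset Printing Implicit Defensive.

Import Order.TTheory GRing.Theory Num.Theory.
Import numFieldNormedType.Exports.

Local Open Scope classical_set_scope.
Local Open Scope ring_scope.

Section power_measure.
Context {disp} {T : measurableType disp} {R : realType}.
Variable m : {sigma_finite_measure set T -> \bar R}.

Definition tuple_cons n (p : T * n.-tuple T) : n.+1.-tuple T :=
  [tuple of p.1 :: p.2].

Lemma measurable_tuple_cons n : measurable_fun setT (@tuple_cons n).
Proof. exact: measurable_cons. Qed.

Section step.
Variables (n : nat) (mu : {sigma_finite_measure set (n.-tuple T) -> \bar R}).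

Definition power_measureS : set (n.+1.-tuple T) -> \bar R :=
  pushforward (m \x mu)%E (@tuple_cons n).

Let mcons (A : set (n.+1.-tuple T)) :
  measurable A -> measurable (@tuple_cons n @^-1` A).
Proof.
by move=> mA; rewrite -[X in measurable X]setTI; exact: measurable_tuple_cons.
Qed.

Let power_measureS0 : power_measureS set0 = 0%E.
Proof. by rewrite /power_measureS /pushforward preimage_set0 measure0. Qed.

Let power_measureS_ge0 A : (0 <= power_measureS A)%E.
Proof. exact: (measure_ge0 (m \x mu)%E). Qed.

Let power_measureS_sigma_additive : semi_sigma_additive power_measureS.
Proof.
move=> F mF tF mUF; rewrite /power_measureS /pushforward preimage_bigcup.
apply: measure_semi_sigma_additive.
- by move=> i; exact: mcons.
- apply/trivIsetP => /= i j _ _ ij; rewrite -preimage_setI.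
  by move/trivIsetP : tF => /(_ _ _ _ _ ij) ->//; rewrite preimage_set0.
- by rewrite -preimage_bigcup; exact: mcons.
Qed.

HB.instance Definition _ := isMeasure.Build _ _ _ power_measureS
  power_measureS0 power_measureS_ge0 power_measureS_sigma_additive.

Let power_measureS_sigma_finite : sigma_finite setT power_measureS.
Proof.
have /sigma_finiteP[F [FT ndF Foo]] := sigma_finiteT m.
have /sigma_finiteP[G [GT ndG Goo]] := sigma_finiteT mu.
pose uncons (t : n.+1.-tuple T) := (thead t, [tuple of behead t] : n.-tuple T).
have consK : cancel (@tuple_cons n) uncons.
  move=> [x t]; rewrite /uncons /tuple_cons; congr (_, _) => /=.
  by apply: val_inj.
have unconsK : cancel uncons (@tuple_cons n) by move=> t; rewrite [RHS]tuple_eta.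
have muncons : measurable_fun setT uncons.
  apply/measurable_fun_pairP; split => /=.
    exact: measurable_tnth.
  exact: measurable_behead.
exists (fun i => uncons @^-1` (F i `*` G i)).
  rewrite -preimage_bigcup (_ : \bigcup_i _ = setT) ?preimage_setT//.
  apply/seteqP; split=> // -[x t] _.
  have [i _ Fix] : (\bigcup_i F i) x by rewrite -FT.
  have [j _ Gjt] : (\bigcup_i G i) t by rewrite -GT.
  exists (maxn i j) => //; split.
    by move: Fix; exact/subsetPset/ndF/leq_maxl.
  by move: Gjt; exact/subsetPset/ndG/leq_maxr.
move=> i; have [mFi Fioo] := Foo i; have [mGi Gioo] := Goo i; split.
  rewrite -[X in measurable X]setTI; apply: muncons => //.
  exact: measurableX.
rewrite /power_measureS /pushforward -comp_preimage.
rewrite (_ : uncons \o _ = id); last exact/funext.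
by rewrite preimage_id product_measure1E// lte_mul_pinfty// ge0_fin_numE.
Qed.

HB.instance Definition _ := Measure_isSigmaFinite.Build _ _ _ power_measureS
  power_measureS_sigma_finite.

End step.

Fixpoint power_measure n : {sigma_finite_measure set (n.-tuple T) -> \bar R} :=
  if n is k.+1 then power_measureS (power_measure k) else \d_[tuple].

Lemma power_measure_box n (A : 'I_n -> set T) :
  (forall i, measurable (A i)) ->
  power_measure n [set x | forall i, A i (tnth x i)] = (\prod_(i < n) m (A i))%E.
Proof.
elim: n A => [|n IHn] A mA.
  rewrite big_ord0 /= diracE mem_set//= => -[].
  by [].
rewrite big_ord_recl -IHn// -product_measure1E//.
  rewrite /= /power_measureS /pushforward; congr (_ _).
  apply/seteqP; split=> -[x t] /=.
    by move=> At; split => [|i]; [exact: (At ord0)|rewrite -(tnthS x); exact: At].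
  by move=> [A0 At] i; case: (unliftP ord0 i) => [j|] ->; rewrite ?tnthS ?tnth0.
rewrite (_ : mkset _ = \bigcap_(i in [set: 'I_n])
    ((tnth (T:=T))^~ i @^-1` A (lift ord0 i))).
  apply: fin_bigcap_measurable => // i _.
  by rewrite -[X in measurable X]setTI; exact: measurable_tnth.
by apply/seteqP; split=> t /= At => [i _|i]; exact: At.
Qed.

End power_measure.

(* The library defines L^1 as the a.e. classes of integrable functions; here
   these classes get their vector space structure and norm. *)
Section L1.
Context {disp} {T : measurableType disp} {R : realType}.
Variable mu : {measure set T -> \bar R}.

Local Notation L1 := (LspaceType1 mu).
Local Open Scope quotient_scope.

Lemma measurable_L1 (f : L1) : measurable_fun setT (f : T -> R).
Proof. exact: (measurable_funPT (repr (LebesgueSpace.sort f))). Qed.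

Lemma L1_Lfun (f : L1) : (f : T -> R) \in Lfun mu 1.
Proof.
rewrite inE; apply/andP; split; rewrite inE/=; first exact: measurable_L1.
by case: f => f [[?]].
Qed.

Lemma L1_eqP (f g : L1) : (f : T -> R) = g %[ae mu] -> f = g.
Proof.
case: f g => [f [[f1]]] [g [[g1]]] /= fg.
have E : f = g.
  by rewrite -[f]reprK -[g]reprK; apply/eqmodP/asboolP.
by rewrite {}E in f1 *; rewrite (Prop_irrelevance f1 g1).
Qed.

Lemma Lnorm_ae_eq (f g : T -> R) : measurable_fun setT f ->
  measurable_fun setT g -> f = g %[ae mu] ->
  ('N[mu]_1[EFin \o f] = 'N[mu]_1[EFin \o g])%E.
Proof.
move=> mf mg fg; rewrite !Lnorm1; apply: ae_eq_integral => //.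
- exact/measurable_EFinP/measurableT_comp.
- exact/measurable_EFinP/measurableT_comp.
- by apply: filterS fg => x /= /(_ I) -> _.
Qed.

Section class.
Variables (f : T -> R) (fL : f \in Lfun mu 1).

Let mf0 : measurable_fun setT (f : T -> measurableTypeR R).
Proof. by move: fL; rewrite inE => /andP[]; rewrite inE. Qed.

Let mf : {mfun T >-> measurableTypeR R} :=
  MeasurableFun.Pack (MeasurableFun.Class
    (@isMeasurableFun.Build _ _ T (measurableTypeR R) f mf0)).
Let q : {mfun_ mu, T >-> measurableTypeR R} := \pi mf.

Let q_ae : (q : T -> R) = f %[ae mu].
Proof.
have /eqmodP /asboolP : mf = repr q %[mod {mfun_ mu, T >-> measurableTypeR R}].
  by rewrite reprK.
exact: ae_eq_sym.
Qed.

Let q_fin : finite_norm mu 1 (q : T -> R).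
Proof.
rewrite /finite_norm (@Lnorm_ae_eq _ f) //.
  by move: fL; rewrite inE => /andP[_]; rewrite inE.
exact: (measurable_funPT (repr q)).
Qed.

Definition L1_class : L1 :=
  @LebesgueSpace.Pack _ _ _ _ _ (lexx 1%E) q
    (LebesgueSpace.Class (isFinLebesgue.Build _ _ _ mu 1%E (lexx 1%E) q q_fin)).

Lemma L1_classE : (L1_class : T -> R) = f %[ae mu].
Proof. exact: q_ae. Qed.

End class.

HB.instance Definition _ := gen_eqMixin L1.
HB.instance Definition _ := gen_choiceMixin L1.

Let addL (f g : L1) :=
  (Lfun_addr_closed mu (lexx 1%E)).2 _ _ (L1_Lfun f) (L1_Lfun g).
Let oppL (f : L1) := Lfun_oppr_closed (L1_Lfun f).
Let scaleL (a : R) (f : L1) : (a \o* (f : T -> R)) \in Lfun mu 1 :=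
  Lfun_scale a (lexx 1) (L1_Lfun f).
Let zeroL := (Lfun_addr_closed mu (lexx 1%E)).1.

Definition L1_zero : L1 := L1_class zeroL.
Definition L1_add (f g : L1) : L1 := L1_class (addL f g).
Definition L1_opp (f : L1) : L1 := L1_class (oppL f).
Definition L1_scale (a : R) (f : L1) : L1 := L1_class (scaleL a f).

Lemma L1_zeroE : \forall x \ae mu, L1_zero x = 0.
Proof. by apply: filterS (L1_classE zeroL) => x /(_ I). Qed.

Lemma L1_addE f g : \forall x \ae mu, L1_add f g x = f x + g x.
Proof. by apply: filterS (L1_classE (addL f g)) => x /(_ I). Qed.

Lemma L1_oppE f : \forall x \ae mu, L1_opp f x = - f x.
Proof. by apply: filterS (L1_classE (oppL f)) => x /(_ I). Qed.

Lemma L1_scaleE a f : \forall x \ae mu, L1_scale a f x = a * f x.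
Proof.
by apply: filterS (L1_classE (scaleL a f)) => x /(_ I) ->; rewrite /= mulrC.
Qed.

Lemma L1_addA : associative L1_add.
Proof.
move=> f g h; apply: L1_eqP.
apply: filterS2 (filterI (L1_addE g h) (L1_addE f (L1_add g h)))
  (filterI (L1_addE f g) (L1_addE (L1_add f g) h)) => x /= [ghE ->] [fgE ->] _.
by rewrite ghE fgE addrA.
Qed.

Lemma L1_addC : commutative L1_add.
Proof.
move=> f g; apply: L1_eqP.
by apply: filterS2 (L1_addE f g) (L1_addE g f) => x /= -> -> _; rewrite addrC.
Qed.

Lemma L1_add0 : left_id L1_zero L1_add.
Proof.
move=> f; apply: L1_eqP.
by apply: filterS2 L1_zeroE (L1_addE L1_zero f) => x /= + -> => -> _; rewrite add0r.
Qed.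

Lemma L1_addN : left_inverse L1_zero L1_opp L1_add.
Proof.
move=> f; apply: L1_eqP.
by apply: filterS3 L1_zeroE (L1_oppE f) (L1_addE (L1_opp f) f) => x /= -> + -> =>
  -> _; rewrite addNr.
Qed.

HB.instance Definition _ :=
  GRing.isZmodule.Build L1 L1_addA L1_addC L1_add0 L1_addN.

Lemma L1_scaleA a b f : L1_scale a (L1_scale b f) = L1_scale (a * b) f.
Proof.
apply: L1_eqP.
by apply: filterS3 (L1_scaleE b f) (L1_scaleE a (L1_scale b f))
  (L1_scaleE (a * b) f) => x /= + -> -> => -> _; rewrite mulrA.
Qed.

Lemma L1_scale1 : left_id 1 L1_scale.
Proof.
by move=> f; apply: L1_eqP; apply: filterS (L1_scaleE 1 f) => x -> _; rewrite mul1r.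
Qed.

Lemma L1_scaleDr : right_distributive L1_scale +%R.
Proof.
move=> a f g; apply: L1_eqP.
apply: filterS3 (filterI (L1_addE f g) (L1_scaleE a (f + g)))
  (filterI (L1_scaleE a f) (L1_scaleE a g))
  (L1_addE (L1_scale a f) (L1_scale a g)).
by move=> x /= [fgE ->] [afE agE] -> _; rewrite fgE afE agE mulrDr.
Qed.

Lemma L1_scaleDl f : {morph L1_scale^~ f : a b / a + b}.
Proof.
move=> a b; apply: L1_eqP.
apply: filterS3 (L1_scaleE (a + b) f) (filterI (L1_scaleE a f)
  (L1_scaleE b f)) (L1_addE (L1_scale a f) (L1_scale b f)).
by move=> x /= -> [afE bfE] -> _; rewrite afE bfE mulrDl.
Qed.

HB.instance Definition _ := GRing.Zmodule_isLmodule.Build R L1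
  L1_scaleA L1_scale1 L1_scaleDr L1_scaleDl.

Definition L1_norm (f : L1) : R := fine ('N[mu]_1[EFin \o f])%E.

Lemma L1_normE f : (L1_norm f)%:E = ('N[mu]_1[EFin \o f])%E.
Proof.
rewrite /L1_norm fineK// ge0_fin_numE ?Lnorm_ge0//.
by have := L1_Lfun f; rewrite inE => /andP[_]; rewrite inE.
Qed.

Lemma L1_normD f g : L1_norm (f + g) <= L1_norm f + L1_norm g.
Proof.
rewrite -lee_fin EFinD !L1_normE.
rewrite (@Lnorm_ae_eq _ ((f : T -> R) \+ g)); last first.
- by apply: filterS (L1_addE f g) => x /= -> _.
- by apply: measurable_funD; exact: measurable_L1.
- exact: measurable_L1.
by apply: eminkowski => //; exact: measurable_L1.
Qed.

Lemma L1_normZ a f : L1_norm (a *: f) = `|a| * L1_norm f.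
Proof.
apply: EFin_inj; rewrite EFinM !L1_normE.
rewrite (@Lnorm_ae_eq _ (a \*: (Lfun_Sub (lexx 1%E) (L1_Lfun f) : T -> R))).
- exact: LnormZ.
- exact: measurable_L1.
- by apply: measurable_funM => //; exact: measurable_L1.
- by apply: filterS (L1_scaleE a f) => x /= -> _.
Qed.

Lemma L1_norm_eq0 f : L1_norm f = 0 -> f = 0.
Proof.
move=> f0; apply: L1_eqP.
have /Lnorm_eq0_eq0 : ('N[mu]_1[EFin \o f])%E = 0%E by rewrite -L1_normE f0.
have mf : measurable_fun setT (EFin \o f).
  by apply/measurable_EFinP; exact: measurable_L1.
move=> /(_ mf lte01); apply: filterS2 L1_zeroE => x /= -> /(_ I) [].
by [].
Qed.

HB.instance Definition _ := Lmodule_isNormed.Build R L1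
  L1_normD L1_normZ L1_norm_eq0.

End L1.

Section operators.
Context {R : realType}.

Definition operator_norm {V W : normedModType R} (A : V -> W) : \bar R :=
  ereal_sup [set `|A x|%:E | x in [set x | `|x| <= 1]].

Definition bounded_operator {V W : normedModType R} (A : {linear V -> W}) :=
  (operator_norm A < +oo)%E.

Record contraction_semigroup {V : normedModType R} (S : R -> {linear V -> V}) :
    Prop := {
  semigroup0 : forall x, S 0 x = x;
  semigroupD : forall (s t : R) x, 0 <= s -> 0 <= t -> S (s + t) x = S s (S t x);
  semigroup_contraction : forall t : R, 0 <= t -> (operator_norm (S t) <= 1)%E;
  semigroup_continuous : forall x, S t x @[t --> 0^'+] --> x }.

(* [A] is everywhere defined: a bounded generator has full domain, the domain
   of a generator being dense and its graph closed. *)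
Definition generator {V : normedModType R} (S : R -> {linear V -> V})
    (A : V -> V) :=
  forall x, t^-1 *: (S t x - x) @[t --> 0^'+] --> A x.

Definition contraction_generator {V : normedModType R} (A : V -> V) :=
  exists2 S, contraction_semigroup S & generator S A.

End operators.

Section configurations.
Variables (R : realType) (d : nat).

(* [power_measure lebesgue_measure d] is Lebesgue measure on R^d, and its n-th
   power is dx_1 ... dx_n on (R^d)^n. *)
Definition lebesgue_power n :
    {sigma_finite_measure
      set (n.-tuple (d.-tuple (measurableTypeR R))) -> \bar R} :=
  power_measure (power_measure lebesgue_measure d) n.

Definition X n : normedModType R :=
  if n is k.+1 then LspaceType1 (lebesgue_power k.+1) else R^o.

Definition permutation_invariant {T : Type} n (g : n.-tuple T -> R) :=
  forall (s : 'S_n) (x : n.-tuple T), g [tuple tnth x (s i) | i < n] = g x.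

(* Elements of [X n] are classes of functions modulo a.e. equality: a class is
   symmetric when it contains a symmetric function. *)
Definition symmetric_class n : set (X n) :=
  match n with
  | 0%N => setT
  | k.+1 => [set f : LspaceType1 (lebesgue_power k.+1) |
      exists g : k.+1.-tuple (d.-tuple (measurableTypeR R)) -> R,
        [/\ measurable_fun setT g, permutation_invariant g &
            (f : _ -> R) = g %[ae lebesgue_power k.+1]]]
  end.

(* A function G on Gamma_0 is the sequence of its components G^(n). *)
Definition component_sequence := forall n, X n.

Definition norm_LC (C : R) (G : component_sequence) : \bar R :=
  (\sum_(0 <= n <oo) (C ^+ n / n`!%:R * `|G n|)%:E)%E.

Definition LC (C : R) : set component_sequence :=
  [set G | (forall n, symmetric_class (G n)) /\ (norm_LC C G < +oo)%E].

(* [L0 n] is L_0^(n+1) and [W n] is W^(n+1) : X_n -> X_(n+1). *)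
Definition L0_op (L0 : forall n, X n.+1 -> X n.+1) (G : component_sequence) :
    component_sequence :=
  fun n => if n is k.+1 return X n then L0 k (G k.+1) else 0.

Definition W_op (W : forall n, X n -> X n.+1) (G : component_sequence) :
    component_sequence :=
  fun n => if n is k.+2 return X n then W k.+1 (G k.+1) else 0.

(* The equation holds in each X_n, n >= 1, as a derivative in norm; the initial
   value is attained in norm as t -> 0+. Only times t >= 0 are relevant. *)
Record IVP_solution (L0 : forall n, X n.+1 -> X n.+1)
    (W : forall n, X n -> X n.+1) (G0 : component_sequence)
    (G : R -> component_sequence) : Prop := {
  IVP_initial : forall n, G 0 n = G0 n;
  IVP_continuous : forall n, G t n @[t --> 0^'+] --> G0 n;
  IVP_component0 : forall t : R, 0 <= t -> G t 0%N = G0 0%N;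
  IVP_equation : forall n (t : R), (1 <= n)%N -> 0 < t ->
    is_derive t 1 (fun s => G s n) (L0_op L0 (G t) n + W_op W (G t) n) }.

Definition rho (B C t : R) : R := C / (1 + B * C * t).

End configurations.

(* Main.v *)
Require Import Defs.
From mathcomp Require Import all_boot all_order all_algebra.
From mathcomp Require Import all_classical all_reals all_analysis.
From mathcomp Require Import measurable_realfun ring lra.
Import Order.TTheory GRing.Theory Num.Theory.
Import numFieldNormedType.Exports.
Local Open Scope classical_set_scope.
Local Open Scope ring_scope.

(** Write [A G := L0 G + W G]. The n-th component of [A G] involves only finitely
    many components of [G], so [|(A^k G)^(n)|] grows geometrically in [k], and
    [G_t^(n) = sum_k t^k / k! (A^k G_0)^(n)] converges in [X_n], can be
    differentiated term by term and solves the problem. For any solution,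
    contractivity of the semigroup of [L_0^(n)] bounds the upper right derivative
    of [|G_t^(n)|] by [|W^(n) G_t^(n-1)| <= B n (n-1) |G_t^(n-1)|]. Applied to the
    difference of two solutions, inductively in [n], this yields uniqueness. As
    [rho' = - B rho^2], the upper right derivative of
    [sum_(n <= N) rho(t)^n / n! |G_t^(n)|] telescopes to
    [- B N rho^(N+1) / N! |G_t^(N)| <= 0], which gives the norm bound. *)

(** * One-sided slopes *)

Lemma is_derive_right {R : realType} {V : normedModType R} (f : R -> V) (t : R)
    (df : V) :
  is_derive t 1 f df -> h^-1 *: (f (t + h) - f t) @[h --> 0^'+] --> df.
Proof.
move=> [+ <-] => /cvg_ex[l fl]; rewrite /derive (cvg_lim _ fl)//.
apply: (@cvg_trans _ (h^-1 *: ((f \o shift t) (h *: 1) - f t) @[h --> 0^'+])).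
  by apply: near_eq_cvg; near=> h; rewrite /= [h%:A]mulr1 [t + h]addrC.
exact: cvg_dnbhs_at_right.
Unshelve. all: by end_near. Qed.

(* [l] is an upper bound of the upper right Dini derivative of [f] at [t]. *)
Definition upper_right_slope {R : realType} (f : R -> R) (t l : R) :=
  exists2 q : R -> R, q h @[h --> 0^'+] --> l &
    \forall h \near 0^'+, f (t + h) - f t <= h * q h.

Lemma upper_right_slope_le {R : realType} (f : R -> R) (t l m : R) :
  l <= m -> upper_right_slope f t l -> upper_right_slope f t m.
Proof.
move=> lm [q ql fq]; exists (fun h => q h + (m - l)).
  by rewrite -[m in X in _ --> X](subrKC l); apply: cvgD => //; exact: cvg_cst.
near=> h; have h0 : 0 < h by near: h; exact: nbhs_right_gt.
apply: (@le_trans _ _ (h * q h)); first by near: h.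
by rewrite ler_pM2l// lerDl subr_ge0.
Unshelve. all: by end_near. Qed.

Lemma upper_right_slopeD {R : realType} (f g : R -> R) (t l m : R) :
  upper_right_slope f t l -> upper_right_slope g t m ->
  upper_right_slope (fun s => f s + g s) t (l + m).
Proof.
move=> [q ql fq] [r rm gr]; exists (fun h => q h + r h); first exact: cvgD.
by near=> h; rewrite mulrDr opprD addrACA lerD//; near: h.
Unshelve. all: by end_near. Qed.

Lemma cvg_right_shift {R : realType} {V : topologicalType} (f : R -> V) (t : R) :
  {for t, continuous f} -> f (t + h) @[h --> 0^'+] --> f t.
Proof.
by move=> /cvg_at_right_filter fc A /fc ft; apply/(nbhs_right0P t (f @^-1` A)).
Qed.

Lemma is_derive_continuous {R : realType} {V : normedModType R} (f : R -> V)
    (t : R) (df : V) : is_derive t 1 f df -> {for t, continuous f}.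
Proof.
by move=> [/derivable1_diffP/differentiable_continuous].
Qed.

(** Product rule for a weight: in [w(t+h) u(t+h) - w(t) u(t) = (w(t+h) - w(t)) u(t) + w(t+h) (u(t+h)
    - u(t))] only the increment of [u] is estimated, and nonnegativity of [w] keeps the direction of
    the inequality. *)
Lemma upper_right_slopeM {R : realType} (w u : R -> R) (t dw l : R) :
  0 <= t -> (forall s, 0 <= s -> 0 <= w s) ->
  is_derive t 1 w dw -> upper_right_slope u t l ->
  upper_right_slope (fun s => w s * u s) t (dw * u t + w t * l).
Proof.
move=> t0 w0 dwt [q ql uq].
have dwP := is_derive_right _ _ _ dwt.
have wc := cvg_right_shift _ _ (is_derive_continuous _ _ _ dwt).
exists (fun h => h^-1 * (w (t + h) - w t) * u t + w (t + h) * q h).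
  by apply: cvgD; apply: cvgM => //; exact: cvg_cst.
near=> h.
have h0 : 0 < h by near: h; exact: nbhs_right_gt.
have -> : h * (h^-1 * (w (t + h) - w t) * u t + w (t + h) * q h) =
    (w (t + h) - w t) * u t + w (t + h) * (h * q h).
  by field; rewrite gt_eqF.
have -> : w (t + h) * u (t + h) - w t * u t =
    (w (t + h) - w t) * u t + w (t + h) * (u (t + h) - u t) by ring.
rewrite lerD2l; apply: ler_wpM2l; first by rewrite w0// addr_ge0// ltW.
by near: h.
Unshelve. all: by end_near. Qed.

(** Continuous induction: after tilting [f] by a small slope [k > 0], the set of points of [[a, b]]
    where the tilted increment [g] is nonpositive cannot end before [b]. *)
Lemma ler_upper_right_slope_segment {R : realType} (f : R -> R) (a b : R) :
  (forall t, a <= t -> {for t, continuous f}) ->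
  (forall t, a <= t -> exists2 l, l <= 0 & upper_right_slope f t l) ->
  a < b -> f b <= f a.
Proof.
move=> fc fs ab; apply/ler_addgt0Pr => e e0.
(* Chosen so that the tilt costs exactly [e] over the whole segment. *)
pose k := e / (b - a).
have k0 : 0 < k by rewrite divr_gt0// subr_gt0.
pose g r := f r - f a - k * (r - a).
suff gb : g b <= 0.
  by move: gb; rewrite /g /k divfK ?subr_eq0 ?gt_eqF//; lra.
have gc t : a <= t -> {for t, continuous g}.
  move=> at_; apply: cvgB; first by apply: cvgB; [exact: fc|exact: cvg_cst].
  by apply: cvgM; [exact: cvg_cst|apply: cvgB; [exact: cvg_id|exact: cvg_cst]].
pose S := [set r | a <= r <= b /\ g r <= 0].
have Sa : S a by split; [rewrite lexx ltW|rewrite /g !subrr mulr0 subrr].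
have supS : has_sup S by split; [exists a|exists b => r [/andP[]]].
have aS : a <= sup S by exact: ub_le_sup supS.2 _ Sa.
have Sb : sup S <= b by apply: ge_sup; [exists a|move=> r [/andP[]]].
(* The supremum is attained: if [g] were positive there, continuity would make it positive at nearby
   points of [S]. *)
have gS : g (sup S) <= 0.
  rewrite leNgt; apply/negP => gS0.
  have /nbhs_ballP[d /= d0 dg] : \forall r \near sup S, 0 < g r.
    exact: (cvgr_gt _ (gc _ aS) _ gS0).
  have [r Sr rS] := sup_adherent d0 supS.
  have := dg r; rewrite /ball/= ger0_norm ?subr_ge0; last first.
    exact: ub_le_sup supS.2 _ Sr.
  by rewrite ltrBlDl -ltrBlDr => /(_ rS); rewrite ltNge Sr.2.
move: Sb; rewrite le_eqVlt => /predU1P[<-//|Sb].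
have [l l0 [q ql fq]] := fs _ aS.
have qk : \forall h \near 0^'+, q h <= k.
  by apply: (cvgr_le _ ql); exact: le_lt_trans k0.
(* A small step to the right of [sup S] raises [f] by at most [h * k], so it stays in [S], which
   contradicts the choice of the supremum. *)
exfalso; near (0 : R)^'+ => h.
have h0 : 0 < h by near: h; exact: nbhs_right_gt.
have hb : sup S + h <= b.
  rewrite -lerBrDl; near: h; apply: nbhs_right_le.
  by rewrite subr_gt0.
have : S (sup S + h).
  split; first by rewrite hb andbT (le_trans aS)// lerDl ltW.
  have fh : f (sup S + h) - f (sup S) <= h * q h by near: h.
  have qh : h * q h <= h * k by apply: ler_wpM2l; [exact: ltW|near: h].
  by move: gS; rewrite /g; nra.
by move=> /(ub_le_sup supS.2); rewrite leNgt ltrDl h0.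
Unshelve. all: by end_near. Qed.

(** The endpoint [a] only needs right continuity: compare on [[c, b]] with [c > a] and let [c]
    decrease to [a]. This fits an equation that holds for positive times only. *)
Lemma ler_upper_right_slope {R : realType} (f : R -> R) (a b : R) :
  f t @[t --> a^'+] --> f a ->
  (forall t, a < t -> {for t, continuous f}) ->
  (forall t, a < t -> exists2 l, l <= 0 & upper_right_slope f t l) ->
  a <= b -> f b <= f a.
Proof.
move=> fa fc fs; rewrite le_eqVlt => /predU1P[->//|ab].
apply: (closed_cvg _ (@closed_ge R (f b)) _ _ fa).
near=> c; apply: ler_upper_right_slope_segment => [t|t|].
- by move=> ct; apply: fc; apply: lt_le_trans ct; near: c; exact: nbhs_right_gt.
- by move=> ct; apply: fs; apply: lt_le_trans ct; near: c; exact: nbhs_right_gt.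
- by near: c; exact: nbhs_right_lt.
Unshelve. all: by end_near. Qed.

(** * Operators between normed modules *)

Lemma operator_norm_le {R : realType} {V W : normedModType R}
    (A : {linear V -> W}) (M : R) (x : V) :
  (operator_norm A <= M%:E)%E -> `|A x| <= M * `|x|.
Proof.
move=> AM; have [->|x0] := eqVneq x 0; first by rewrite linear0 !normr0 mulr0.
have n0 : 0 < `|x| by rewrite normr_gt0.
rewrite -ler_pdivrMr// -lee_fin; apply: le_trans AM.
apply: ereal_sup_ubound; exists (`|x|^-1 *: x) => /=.
  by rewrite normrZ gtr0_norm ?invr_gt0// mulVf// gt_eqF.
by rewrite linearZ normrZ gtr0_norm ?invr_gt0// mulrC.
Qed.

Lemma bounded_operatorP {R : realType} {V W : normedModType R}
    (A : {linear V -> W}) : bounded_operator A ->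
  exists2 M, 0 <= M & forall x, `|A x| <= M * `|x|.
Proof.
rewrite /bounded_operator => Aoo.
have A0 : (0 <= operator_norm A)%E.
  apply: ereal_sup_ubound; exists 0 => /=; first by rewrite normr0 ler01.
  by rewrite linear0 normr0.
exists (fine (operator_norm A)) => [|x]; first exact: fine_ge0.
by apply: operator_norm_le; rewrite fineK// ge0_fin_numE.
Qed.

Lemma bounded_operator_cvg {R : realType} {V W : normedModType R}
    (A : {linear V -> W}) {T : Type} (F : set_system T) {FF : Filter F}
    (f : T -> V) (x : V) :
  bounded_operator A -> f s @[s --> F] --> x -> A (f s) @[s --> F] --> A x.
Proof.
move=> /bounded_operatorP[M M0 AM] fx.
suff /linear_bounded_continuous Ac : bounded_near A (nbhs 0).
  exact: cvg_comp fx (Ac x).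
apply/linear_boundedP.
near=> r => y; apply: (le_trans (AM y)); apply: ler_wpM2r => //.
Unshelve. all: by end_near. Qed.

(* Contractivity of the semigroup makes the first-order expansion
   [x + h L x = S_h x + o(h)] have norm at most [|x| + o(h)]. *)
Lemma upper_right_slope_norm {R : realType} {V : normedModType R}
    (L : V -> V) (u : R -> V) (t : R) (f : V) :
  contraction_generator L -> is_derive t 1 u (L (u t) + f) ->
  upper_right_slope (fun s => `|u s|) t `|f|.
Proof.
move=> [S [S0 SD Sc Scont] SL] /is_derive_right du.
(* The two added terms are the errors of the difference quotients of [u] and of the semigroup; both
   tend to 0. *)
exists (fun h => `|f| + `|h^-1 *: (u (t + h) - u t) - (L (u t) + f)| +
    `|L (u t) - h^-1 *: (S h (u t) - u t)|).
  have cvg_norm0 (g : R -> V) : g h @[h --> 0^'+] --> 0 ->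
      `|g h| @[h --> 0^'+] --> (0 : R) by move=> /cvg_norm; rewrite normr0.
  rewrite -[X in _ --> X]addr0 -[X in _ --> X + _]addr0.
  apply: cvgD; first apply: cvgD; first exact: cvg_cst.
    apply: cvg_norm0; rewrite -(subrr (L (u t) + f)).
    by apply: cvgB => //; exact: cvg_cst.
  apply: cvg_norm0; rewrite -(subrr (L (u t))).
  by apply: cvgB; [exact: cvg_cst|exact: SL].
near=> h.
have h0 : 0 < h by near: h; exact: nbhs_right_gt.
have hZ (v : V) : h * `|v| = `|h *: v| by rewrite normrZ gtr0_norm.
have Sh : `|S h (u t)| <= `|u t|.
  by rewrite -[leRHS]mul1r; apply/operator_norm_le/Sc/ltW.
rewrite lerBlDl; apply: le_trans (lerD Sh (lexx _)).
rewrite !mulrDr !hZ.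
rewrite [X in `|X| <= _](_ : _ = S h (u t) + (h *: f +
   (h *: (h^-1 *: (u (t + h) - u t) - (L (u t) + f))) +
    h *: (L (u t) - h^-1 *: (S h (u t) - u t)))).
  apply: (le_trans (ler_normD _ _)); rewrite lerD2l.
  apply: (le_trans (ler_normD _ _)); rewrite lerD2r.
  exact: ler_normD.
rewrite !(scalerBr h) !scalerA divff ?gt_eqF// !scale1r scalerDr.
move: (u (t + h)) (u t) (S h (u t)) (h *: L (u t)) (h *: f) => a b s l g.
rewrite (opprD l) (addrA (a - b)) (addrC g).
rewrite (subrK g) (addrA _ l) (subrK l) (opprB s).
by rewrite (addrA _ b) (subrK b) (addrC s) (subrK s).
Unshelve. all: by end_near. Qed.

(** * Exponential series with vector coefficients *)

(** The second-order Taylor remainder of a power, by induction on [k]. The crude geometric factor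
    [(2 T)^k] is chosen because, divided by [k!], it sums to an exponential. *)
Lemma exprD_remainder {R : realFieldType} (t h T : R) (k : nat) :
  1 <= T -> `|t| <= T -> `|t + h| <= T ->
  `|(t + h) ^+ k - t ^+ k - h * (k%:R * t ^+ k.-1)| <= h ^+ 2 * (2 * T) ^+ k.
Proof.
move=> T1 tT thT; have T0 : 0 <= T by apply: le_trans T1.
elim: k => [|k IH].
  by rewrite !expr0 mul0r mulr0 subrr subr0 normr0 mulr1 sqr_ge0.
have -> : (t + h) ^+ k.+1 - t ^+ k.+1 - h * (k.+1%:R * t ^+ k) =
    (t + h) * ((t + h) ^+ k - t ^+ k - h * (k%:R * t ^+ k.-1)) +
    h ^+ 2 * (k%:R * t ^+ k.-1).
  case: k {IH} => [|k /=]; first by rewrite !expr0 !expr1; ring.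
  by rewrite -natr1 !exprS; ring.
apply: (le_trans (ler_normD _ _)).
have h2 : 0 <= h ^+ 2 by exact: sqr_ge0.
have hk : `|h ^+ 2 * (k%:R * t ^+ k.-1)| <= h ^+ 2 * (2 * T) ^+ k.
  rewrite normrM (ger0_norm h2); apply: ler_wpM2l => //.
  rewrite normrM normrX ger0_norm// exprMn; apply: ler_pM => //.
    by rewrite -natrX ler_nat ltnW// ltn_expl.
  apply: (@le_trans _ _ (T ^+ k.-1)); first by rewrite lerXn2r.
  by rewrite ler_weXn2l// leq_pred.
have hM : `|(t + h) * ((t + h) ^+ k - t ^+ k - h * (k%:R * t ^+ k.-1))| <=
    T * (h ^+ 2 * (2 * T) ^+ k) by rewrite normrM; apply: ler_pM.
(* With [P = h^2 (2 T)^k] the two bounds add up to [T P + P], which is at most [2 T P] since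
   [T >= 1]. *)
apply: (le_trans (lerD hM hk)); rewrite [_ ^+ k.+1]exprS (mulrCA (h ^+ 2)).
have : 0 <= h ^+ 2 * (2 * T) ^+ k by rewrite mulr_ge0// exprn_ge0// mulr_ge0.
by move: (h ^+ 2 * (2 * T) ^+ k) => P P0; nra.
Qed.

Lemma is_derive_quadratic_remainder {R : realType} {V : normedModType R}
    (f : R -> V) (t D : R) (df : V) :
  (forall h, `|h| <= 1 -> `|f (t + h) - f t - h *: df| <= h ^+ 2 * D) ->
  is_derive t 1 f df.
Proof.
move=> fD.
have D0 : 0 <= D.
  by have := fD 1; rewrite normr1 expr1n mul1r => /(_ (lexx _)); apply: le_trans.
have cf : h^-1 *: ((f \o shift t) (h *: 1) - f t) @[h --> 0^'] --> df.
  apply/cvgrPdistC_le => e e0; near=> h.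
  have h0 : h != 0 by near: h; exact: nbhs_dnbhs_neq.
  have h1 : `|h| <= 1.
    near: h; apply: dnbhs0_le; exact: ltr01.
  (* The denominator is [D + 1] because [D] may vanish. *)
  have hD : `|h| <= e / (D + 1).
    by near: h; apply: dnbhs0_le; rewrite divr_gt0// ltr_wpDl.
  rewrite /= [h%:A]mulr1 [h + t]addrC.
  have {1}-> : df = h^-1 *: (h *: df) by rewrite scalerA mulVf// scale1r.
  rewrite -scalerBr normrZ normfV ler_pdivrMl ?normr_gt0//.
  apply: le_trans (fD _ h1) _.
  have -> : h ^+ 2 = `|h| * `|h| by rewrite -expr2 real_normK ?num_real.
  rewrite -mulrA; apply: ler_wpM2l => //.
  have : `|h| * (D + 1) <= e by rewrite -ler_pdivlMr// ltr_wpDl.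
  by apply: le_trans; apply: ler_wpM2l => //; rewrite lerDl.
exact: DeriveDef (cvgP _ cf) (cvg_lim _ cf).
Unshelve. all: by end_near. Qed.

(** Term-by-term differentiation: the first-order remainders of the partial sums are at most
    [h^2 K exp(2 T M)] uniformly in the number of terms, and the bound passes to the limit. *)
Lemma is_derive_exp_series {R : realType} {V : normedModType R} (x : nat -> V)
    (f f' : R -> V) (K M : R) :
  0 <= M -> (forall k, `|x k| <= K * M ^+ k) ->
  (forall t, series (fun k => exp_coeff t k *: x k) @ \oo --> f t) ->
  (forall t, series (fun k => exp_coeff t k *: x k.+1) @ \oo --> f' t) ->
  forall t : R, is_derive t 1 f (f' t).
Proof.
move=> M0 xM fs f's t.
have K0 : 0 <= K by have := xM 0%N; rewrite expr0 mulr1; apply: le_trans.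
pose T := `|t| + 1; have T1 : 1 <= T by rewrite lerDr.
apply: (@is_derive_quadratic_remainder _ _ _ _ (K * expR (2 * T * M))) => h h1.
(* Differentiation lowers the degree by one, so [N.+1] terms of the series are matched with [N]
   terms of the derived one. *)
pose u N := series (fun k => exp_coeff (t + h) k *: x k) N.+1 -
   series (fun k => exp_coeff t k *: x k) N.+1 -
   h *: series (fun k => exp_coeff t k *: x k.+1) N.
have uE N : u N = \sum_(0 <= k < N.+1)
    (((t + h) ^+ k - t ^+ k - h * (k%:R * t ^+ k.-1)) / k`!%:R) *: x k.
  rewrite /u /series /= -sumrB [X in _ = X]big_nat_recl// [X in X - _]big_nat_recl//.
  rewrite !expr0 mulr0n mul0r mulr0 !subrr mul0r scale0r !add0r.
  rewrite scaler_sumr -sumrB.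
  apply: eq_bigr => k _; rewrite scalerA -2!scalerBl; congr (_ *: _).
  rewrite /exp_coeff /= factS natrM.
  by field; rewrite nat1r !pnatr_eq0 -lt0n fact_gt0.
have ucvg : u @ \oo --> f (t + h) - f t - h *: f' t.
  have shift g l : series g @ \oo --> l -> series g N.+1 @[N --> \oo] --> (l : V).
    by move=> gl; rewrite (cvg_shiftS (series g)).
  apply: cvgB; first by apply: cvgB; apply: shift.
  by apply: cvgZl_tmp.
apply: (closed_cvg _ (@closed_le R (h ^+ 2 * _)) _ _ (cvg_norm ucvg)).
near=> N.
rewrite uE; apply: (le_trans (ler_norm_sum _ _ _)).
have E0 : 0 <= 2 * T * M by rewrite !mulr_ge0// (le_trans ler01).
have eN : series (exp_coeff (2 * T * M)) N.+1 <= expR (2 * T * M).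
  apply: nondecreasing_cvgn_le; last exact: is_cvg_series_exp_coeff.
  by apply: nondecreasing_series => k _ _; exact: exp_coeff_ge0.
apply: (@le_trans _ _ (h ^+ 2 * (K * series (exp_coeff (2 * T * M)) N.+1))); last first.
  apply: ler_wpM2l; first exact: sqr_ge0.
  by apply: ler_wpM2l.
rewrite /series/= !mulr_sumr; apply: ler_sum => k _.
rewrite normrZ normrM /exp_coeff /= normfV (ger0_norm (ler0n _ _)).
have -> : h ^+ 2 * (K * ((2 * T * M) ^+ k / k`!%:R)) =
    (h ^+ 2 * (2 * T) ^+ k / k`!%:R) * (K * M ^+ k).
  by rewrite exprMn; field; rewrite pnatr_eq0 -lt0n fact_gt0.
apply: ler_pM; rewrite ?mulr_ge0 ?invr_ge0//.
apply: ler_wpM2r; first by rewrite invr_ge0.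
apply: exprD_remainder => //; first by rewrite lerDl.
by apply: (le_trans (ler_normD _ _)); rewrite lerD2l.
Unshelve. all: by end_near. Qed.

(** * Absolutely convergent series in L^1 *)

Section L1_series.
Context {disp : measure_display} {T : measurableType disp} {R : realType}.
Variable mu : {measure set T -> \bar R}.

Lemma L1_sumE (f : nat -> LspaceType1 mu) (g : nat -> T -> R) n :
  (forall k, (f k : T -> R) = g k %[ae mu]) ->
  (series f n : T -> R) = (fun x => series (g^~ x) n) %[ae mu].
Proof.
move=> fg; elim: n => [|n IHn].
  rewrite /series /=.
  by apply: filterS (L1_zeroE mu) => x; rewrite !big_geq.
rewrite seriesSr.
apply: filterS3 (L1_addE (series f n) (f n)) IHn (fg n) => x.
by rewrite seriesSr => -> -> // -> //.
Qed.

(* The limit is a pointwise limit of representatives, hence is as symmetric as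
   they are; the upper limit makes it an everywhere defined measurable function. *)
Lemma L1_series_cvg (f : nat -> LspaceType1 mu) (g : nat -> T -> R) :
  (forall k, measurable_fun setT (g k)) ->
  (forall k, (f k : T -> R) = g k %[ae mu]) ->
  cvgn (series (fun k => `|f k|)) ->
  exists2 F : LspaceType1 mu, series f @ \oo --> F &
    (F : T -> R) =
      (fun x => fine (limn_esup (fun n => (series (g^~ x) n)%:E))) %[ae mu].
Proof.
move=> mg fg cf.
(* [H] dominates all partial sums. Its integral is the sum of the norms, so it is finite almost
   everywhere and dominated convergence applies. *)
pose H x := (\sum_(0 <= k <oo) `|g k x|%:E)%E.
pose s n x := series (g^~ x) n.
pose G x := fine (limn_esup (fun n => (s n x)%:E)).
have ms n : measurable_fun setT (s n) by exact: measurable_sum.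
have mG : measurable_fun setT G.
  apply: measurableT_comp; first exact: fine_measurable.
  by apply: measurable_fun_limn_esup => n; exact/measurable_EFinP.
have mH : measurable_fun setT H.
  apply: ge0_emeasurable_sum => [k x _ _|k _]; first by rewrite lee_fin.
  exact/measurable_EFinP/measurableT_comp.
have nf k : (\int[mu]_x `|g k x|%:E)%E = `|f k|%:E.
  rewrite [RHS]L1_normE Lnorm1; apply/esym/ae_eq_integral => //.
  - by apply/measurable_EFinP/measurableT_comp => //; exact: measurable_L1.
  - exact/measurable_EFinP/measurableT_comp.
  - by apply: filterS (fg k) => x /(_ I) /= -> _.
have iH : mu.-integrable setT H.
  apply/integrableP; split => //.
  under eq_integral.
    move=> x _; rewrite gee0_abs; last first.
      by apply: nneseries_ge0 => k _ _; rewrite lee_fin.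
    over.
  rewrite integral_nneseries; last 3 first.
  - by [].
  - by move=> k; exact/measurable_EFinP/measurableT_comp.
  - by move=> k x _; rewrite lee_fin.
  under eq_eseriesr do rewrite nf.
  apply: (@le_lt_trans _ _ (limn (series (fun k => `|f k|)))%:E); last exact: ltry.
  apply: lime_le; first by apply: is_cvg_nneseries => k _ _; rewrite lee_fin.
  apply: nearW => n; rewrite sumEFin lee_fin.
  by apply: nondecreasing_cvgn_le cf n; apply: nondecreasing_series.
have sG : {ae mu, forall x, setT x -> (s n x)%:E @[n --> \oo] --> (G x)%:E}.
  apply: filterS (integrable_ae measurableT iH) => x /(_ I) Hx _.
  have : cvgn (series (g^~ x)).
    apply: normed_cvg; apply: nnseries_is_cvg => [k|/=]; first exact: normr_ge0.
    by rewrite -ge0_fin_numE//; apply: nneseries_ge0 => k _ _; rewrite lee_fin.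
  move=> /cvg_ex[l sl].
  have sle : (s n x)%:E @[n --> \oo] --> l%:E.
    by apply: cvg_EFin => //; apply: nearW.
  (* Where the series converges, the upper limit is its sum. *)
  by rewrite /G (cvg_limn_einf_sup sle).
have sH n x : (`|(s n x)%:E| <= H x)%E.
  apply: (@le_trans _ _ (\sum_(0 <= k < n) `|g k x|%:E)%E).
    by rewrite sumEFin lee_fin; exact: ler_norm_sum.
  by apply: nneseries_lim_ge => k _ _; rewrite lee_fin.
have msE n : measurable_fun setT (EFin \o s n) by exact/measurable_EFinP.
have mGE : measurable_fun setT (EFin \o G) by exact/measurable_EFinP.
have [iG sG0 _] := dominated_convergence measurableT msE mGE sG iH
   (filterE _ (fun x n _ => sH n x)).
have /Lfun1_integrable LG := iG.
exists (L1_class LG); last exact: L1_classE.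
apply/cvgrPdist_le => e e0.
have /fine_cvg /cvgrPdist_le /(_ _ e0) := sG0.
apply: filterS => n.
have sFE : `|series f n - L1_class LG|%:E = (\int[mu]_x `|s n x - G x|%:E)%E.
  rewrite [LHS]L1_normE (@Lnorm_ae_eq _ _ _ mu _ (s n \- G)) ?Lnorm1//.
  - exact: measurable_L1.
  - exact: measurable_funB.
  - apply: filterS3 (L1_addE (series f n) (- L1_class LG)) (L1_sumE f g n fg)
      (filterI (L1_classE LG) (L1_oppE (L1_class LG))) => x -> + [+ ->] _.
    by move=> -> // -> //.
by rewrite sub0r normrN /= -sFE /= normr_id distrC.
Qed.

End L1_series.

(** * Symmetric classes under sums, multiples and absolutely convergent series *)

Section symmetric_class.
Context {R : realType} {d : nat}.

Lemma symmetric_class0 n : symmetric_class (0 : X R d n).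
Proof.
case: n => [//|n]; exists (cst 0); split=> //.
by apply: filterS (L1_zeroE _) => x -> _.
Qed.

Lemma symmetric_classD n (f g : X R d n) :
  symmetric_class f -> symmetric_class g -> symmetric_class (f + g).
Proof.
case: n f g => [//|n] f g [f' [mf' pf' ff']] [g' [mg' pg' gg']].
exists (f' \+ g'); split; first exact: measurable_funD.
  by move=> s x; rewrite /= pf' pg'.
by apply: filterS3 (L1_addE f g) ff' gg' => x -> + + _ => -> // -> //.
Qed.

Lemma symmetric_classZ n (a : R) (f : X R d n) :
  symmetric_class f -> symmetric_class (a *: f).
Proof.
case: n f => [//|n] f [f' [mf' pf' ff']].
exists (fun x => a * f' x); split; first exact: measurable_funM.
  by move=> s x; rewrite /= pf'.
by apply: filterS2 (L1_scaleE a f) ff' => x -> + _ => -> //.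
Qed.

(** For [n >= 1], choose a symmetric representative of each term. The upper limit of their partial
    sums is permutation invariant at every point and represents the sum. For [n = 0] the space is
    the real line. *)
Lemma symmetric_class_series_cvg n (x : nat -> X R d n) :
  (forall k, symmetric_class (x k)) -> cvgn (series (fun k => `|x k|)) ->
  exists2 y, series x @ \oo --> y & symmetric_class y.
Proof.
case: n x => [|n] x xs cx.
  by exists (limn (series (x : nat -> R^o))) => //; exact: normed_cvg cx.
have [g gP] := choice xs.
have mg k : measurable_fun setT (g k) by have [] := gP k.
have xg k : (x k : _ -> R) = g k %[ae lebesgue_power R d n.+1] by have [] := gP k.
have [y xy yE] := L1_series_cvg _ x g mg xg cx.
exists y => //; eexists; split; last exact: yE.
  apply: measurableT_comp; first exact: fine_measurable.
  by apply: measurable_fun_limn_esup => k; apply/measurable_EFinP/measurable_sum.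
move=> s z; congr (fine (limn_esup _)); apply/funext => k; congr (_%:E).
by apply: eq_bigr => j _; have [_ + _] := gP j; apply.
Qed.

End symmetric_class.

(** * The evolution as an exponential series *)

Lemma lim_series_head {R : realType} {V : normedModType R} (x : nat -> V) :
  (forall k, x k.+1 = 0) -> limn (series x) = x 0%N.
Proof.
move=> x0; apply: cvg_lim => //; rewrite -cvg_shiftS.
apply: cvg_near_cst; apply: nearW => k /=.
by rewrite /series /= big_nat_recl// big1 ?addr0.
Qed.

Section evolution.
Context {R : realType} {d : nat}.
Context (L0 : forall n, {linear X R d n.+1 -> X R d n.+1}).
Context (W : forall n, {linear X R d n -> X R d n.+1}).

Lemma L0_opS (G : component_sequence R d) n :
  L0_op L0 G n.+1 = L0 n (G n.+1).
Proof. by []. Qed.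

Lemma W_op1 (G : component_sequence R d) : W_op W G 1 = 0.
Proof. by []. Qed.

Lemma W_opSS (G : component_sequence R d) n :
  W_op W G n.+2 = W n.+1 (G n.+1).
Proof. by []. Qed.

Lemma W_op_norm_le (G : component_sequence R d) n (w : R) : 0 <= w ->
  (forall x, `|W n x| <= w * `|x|) -> `|W_op W G n.+1| <= w * `|G n|.
Proof.
case: n => [|n] w0 Ww; last by rewrite W_opSS.
by rewrite W_op1 normr0 mulr_ge0.
Qed.

Definition evolution_op (G : component_sequence R d) : component_sequence R d :=
  fun n => L0_op L0 G n + W_op W G n.

(** The exponential of [t] times [evolution_op], applied to [G] and taken in each component
    separately. [limn] is a genuine limit in the situation of [evolution_series]. *)
Definition evolution (G : component_sequence R d) (t : R) :
    component_sequence R d :=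
  fun n => limn (series (fun k => exp_coeff t k *: iter k evolution_op G n)).

Lemma evolution_op0 (G : component_sequence R d) : evolution_op G 0%N = 0.
Proof. exact: addr0. Qed.

Hypothesis L0_bounded : forall n, bounded_operator (L0 n).
Hypothesis W_bounded : forall n, bounded_operator (W n).
Hypothesis L0_symmetric :
  forall n f, symmetric_class f -> symmetric_class (L0 n f).
Hypothesis W_symmetric :
  forall n f, symmetric_class f -> symmetric_class (W n f).

Lemma evolution_op_geometric_bound (G : component_sequence R d) n :
  exists2 K, 0 <= K &
    exists2 M, 0 <= M & forall k, `|iter k evolution_op G n| <= K * M ^+ k.
Proof.
elim: n => [|n [K K0 [M M0 KM]]].
  exists `|G 0%N| => //; exists 1 => // -[|k] /=; rewrite expr1n mulr1//.
  by rewrite evolution_op0 normr0.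
have [l l0 Ll] := bounded_operatorP _ (L0_bounded n).
have [w w0 Ww] := bounded_operatorP _ (W_bounded n).
(* [K'] covers the initial value of component [n.+1] and the constant of component [n]. In the rate
   [M'], [l] and [w] pay for the two operators, and [M] makes the bound on component [n] subordinate
   to the new one. *)
pose K' := K + `|G n.+1|; have K'0 : 0 <= K' by rewrite addr_ge0.
pose M' := l + w + M; have M'0 : 0 <= M' by rewrite !addr_ge0.
exists K' => //; exists M' => //.
elim=> [|k IHk]; first by rewrite expr0 mulr1 /= lerDr.
have P0 : 0 <= K' * M' ^+ k by rewrite mulr_ge0// exprn_ge0.
rewrite iterS /evolution_op exprS mulrCA {1}/M'.
rewrite mulrDl (mulrDl l) -[leLHS]addr0.
apply: lerD; last by rewrite mulr_ge0.
apply: (le_trans (ler_normD _ _)); apply: lerD.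
  by apply: (le_trans (Ll _)); apply: ler_wpM2l.
apply: (@le_trans _ _ (w * `|iter k evolution_op G n|)).
  exact: W_op_norm_le.
apply: ler_wpM2l => //; apply: (le_trans (KM k)).
apply: ler_pM; rewrite ?exprn_ge0// ?lerDl//.
by rewrite lerXn2r ?nnegrE// lerDr addr_ge0.
Qed.

Lemma symmetric_evolution_op (G : component_sequence R d) n :
  (forall n, symmetric_class (G n)) -> symmetric_class (evolution_op G n).
Proof.
move=> Gs; apply: symmetric_classD.
  by case: n => [|n]; [exact: symmetric_class0|exact: L0_symmetric].
case: n => [|[|n]]; [exact: symmetric_class0|exact: symmetric_class0|].
exact: W_symmetric.
Qed.

Lemma symmetric_iter_evolution_op (G : component_sequence R d) k n :
  (forall n, symmetric_class (G n)) ->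
  symmetric_class (iter k evolution_op G n).
Proof.
by move=> Gs; elim: k n => [//|k IHk] n; exact: symmetric_evolution_op.
Qed.

(** The geometric bound on the iterates dominates the norms of the terms by [K] times the
    exponential series of [|t| M]. *)
Lemma evolution_series (G : component_sequence R d) (t : R) n :
  (forall n, symmetric_class (G n)) ->
  series (fun k => exp_coeff t k *: iter k evolution_op G n) @ \oo -->
    evolution G t n /\ symmetric_class (evolution G t n).
Proof.
move=> Gs; have [K K0 [M M0 KM]] := evolution_op_geometric_bound G n.
have [||y xy ys] := @symmetric_class_series_cvg R d n
    (fun k => exp_coeff t k *: iter k evolution_op G n).
- by move=> k; apply/symmetric_classZ/symmetric_iter_evolution_op.
- apply: (@series_le_cvg _ _ (fun k => K * exp_coeff (`|t| * M) k)) => [k|k|k|].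
  + exact: normr_ge0.
  + by rewrite mulr_ge0// exp_coeff_ge0// mulr_ge0.
  + rewrite normrZ /exp_coeff/= normrM normfV normrX (ger0_norm (ler0n _ _)).
    have -> : K * ((`|t| * M) ^+ k / k`!%:R) = `|t| ^+ k / k`!%:R * (K * M ^+ k).
      by rewrite exprMn; ring.
    by apply: ler_wpM2l => //; rewrite divr_ge0.
  + exact: (@is_cvg_seriesZ R (exp_coeff (`|t| * M)) K (is_cvg_series_exp_coeff _)).
by rewrite /evolution (cvg_lim _ xy).
Qed.

Lemma evolutionE0 (G : component_sequence R d) n : evolution G 0 n = G n.
Proof.
rewrite /evolution lim_series_head => [|k].
  by rewrite /exp_coeff /= expr0 fact0 divr1 scale1r.
by rewrite /exp_coeff /= expr0n mul0r scale0r.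
Qed.

Lemma evolution_component0 (G : component_sequence R d) t :
  evolution G t 0%N = G 0%N.
Proof.
rewrite /evolution lim_series_head => [|k].
  by rewrite /exp_coeff /= expr0 fact0 divr1 scale1r.
by rewrite iterS evolution_op0 scaler0.
Qed.

Lemma evolution_op_sum (I : Type) (r : seq I) (c : I -> R)
    (F : I -> component_sequence R d) n :
  evolution_op (fun m => \sum_(i <- r) c i *: F i m) n =
  \sum_(i <- r) c i *: evolution_op (F i) n.
Proof.
rewrite /evolution_op; under eq_bigr do rewrite scalerDr.
rewrite big_split; congr (_ + _).
  case: n => [|n]; first by rewrite big1// => i _; rewrite scaler0.
  rewrite L0_opS linear_sum; apply: eq_bigr => i _.
  by rewrite L0_opS linearZ.
case: n => [|[|n]]; first by rewrite big1// => i _; rewrite scaler0.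
  by rewrite W_op1 big1// => i _; rewrite W_op1 scaler0.
rewrite W_opSS linear_sum; apply: eq_bigr => i _.
by rewrite W_opSS linearZ.
Qed.

(** Bounded linear operators commute with the limit of the partial sums. This identifies the derived
    series, whose coefficients are the shifted iterates, with the right-hand side of the
    equation. *)
Lemma evolution_evolution_op (G : component_sequence R d) (t : R) n :
  (forall n, symmetric_class (G n)) ->
  evolution (evolution_op G) t n = evolution_op (evolution G t) n.
Proof.
move=> Gs; apply: cvg_lim => //.
rewrite (_ : series _ = fun N => evolution_op
   (fun m => series (fun k => exp_coeff t k *: iter k evolution_op G m) N) n).
  have cG m := (evolution_series G t m Gs).1.
  apply: cvgD; first case: n => [|n]; first exact: cvg_cst.
    exact: bounded_operator_cvg (cG _).
  case: n => [|[|n]]; [exact: cvg_cst|exact: cvg_cst|].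
  exact: bounded_operator_cvg (cG _).
apply/funext => N; rewrite /series /=.
rewrite (evolution_op_sum _ _ _ (fun k => iter k evolution_op G)).
by apply: eq_bigr => k _; rewrite -iterSr.
Qed.

Lemma is_derive_evolution (G : component_sequence R d) (t : R) n :
  (forall n, symmetric_class (G n)) ->
  is_derive t 1 (fun s => evolution G s n) (evolution_op (evolution G t) n).
Proof.
move=> Gs; have [K K0 [M M0 KM]] := evolution_op_geometric_bound G n.
rewrite -evolution_evolution_op//.
apply: (is_derive_exp_series (fun k => iter k evolution_op G n) _
   (fun t => evolution (evolution_op G) t n) _ _ M0 KM) => s.
  exact: (evolution_series _ _ _ Gs).1.
rewrite [X in series X](_ : _ =
  fun k => exp_coeff s k *: iter k evolution_op (evolution_op G) n).
  by apply: (evolution_series _ _ _ _).1 => m; exact: symmetric_evolution_op.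
by apply/funext => k; rewrite iterSr.
Qed.

End evolution.

(** * Estimates for solutions *)

Section rho.
Context {R : realType} {B C : R}.
Hypotheses (B0 : 0 <= B) (C0 : 0 < C).

Lemma rho_den_gt0 t : 0 <= t -> 0 < 1 + B * C * t.
Proof. by move=> t0; rewrite ltr_pwDl// !mulr_ge0// ltW. Qed.

Lemma rho_ge0 t : 0 <= t -> 0 <= rho B C t.
Proof. by move=> t0; rewrite /rho divr_ge0 ?ltW// rho_den_gt0. Qed.

Lemma is_derive_rho (t : R) : 0 <= t ->
  is_derive t 1 (rho B C) (- (B * rho B C t ^+ 2)).
Proof.
move=> t0; have den0 : 1 + B * C * t != 0 by rewrite gt_eqF// rho_den_gt0.
have d1 : is_derive t 1 (fun s : R => 1 + B * C * s) (B * C).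
  apply: (is_derive_eq (is_deriveD (is_derive_cst (1 : R) t 1)
    (is_deriveZ (B * C) (is_derive_id t 1)))).
  by rewrite add0r /GRing.scale /= mulr1.
rewrite [X in is_derive _ _ X](_ : rho B C =
  C \*: (fun s : R => (1 + B * C * s)^-1)); last by [].
have d2 := @is_deriveV R (fun s : R => 1 + B * C * s) t _ _ den0 d1.
apply: (is_derive_eq (is_deriveZ C d2)).
rewrite /rho /GRing.scale /=. by field.
Qed.

(** The factor [n + 1] from the power rule reduces [(n + 1)!] to [n!], and [rho' = - B rho^2] raises
    the exponent from [n] to [n + 2]. *)
Lemma is_derive_rho_weight n (t : R) : 0 <= t ->
  is_derive t 1 (fun s => rho B C s ^+ n.+1 / n.+1`!%:R)
    (- (B * rho B C t ^+ n.+2 / n`!%:R)).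
Proof.
move=> t0; have dr := is_derive_rho _ t0.
rewrite [X in is_derive _ _ X](_ : _ = n.+1`!%:R^-1 \*: (rho B C ^+ n.+1)).
  apply: (is_derive_eq (is_deriveZ _ (is_deriveX n.+1 dr))).
  rewrite /GRing.scale /= factS natrM !exprS expr0; field.
  by rewrite nat1r !pnatr_eq0 -lt0n fact_gt0.
by apply/funext => s; rewrite /GRing.scale /= mulrC exprfctE.
Qed.

End rho.

(** * Norm bound and uniqueness for arbitrary solutions *)

Section IVP.
Context {R : realType} {d : nat} {B C : R}.
Context (L0 : forall n, {linear X R d n.+1 -> X R d n.+1}).
Context (W : forall n, {linear X R d n -> X R d n.+1}).
Hypothesis B0 : 0 <= B.
Hypothesis C0 : 0 < C.
Hypothesis L0_contraction : forall n, contraction_generator (L0 n).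
Hypothesis W_le :
  forall n, (operator_norm (W n) <= (B * n.+1%:R * n%:R)%:E)%E.

(** A finite sum, so that limits and slopes can be taken term by term; the index [N] is included. *)
Definition norm_LC_trunc (r : R) (G : component_sequence R d) (N : nat) : R :=
  \sum_(n < N.+1) r ^+ n / n`!%:R * `|G n|.

Section solution.
Context (G0 : component_sequence R d) (G : R -> component_sequence R d).
Hypothesis IVP : IVP_solution L0 W G0 G.

(* The loss [- n rho^(n-1) B rho^2 / n!] coming from [rho' = - B rho^2] cancels
   the gain [B (n+1) n rho^(n+1) / (n+1)!] at the next level, so that only the
   last loss term survives. *)
Lemma upper_right_slope_norm_LC_trunc N t : 0 < t ->
  upper_right_slope (fun s => norm_LC_trunc (rho B C s) (G s) N) t
    (- (B * rho B C t ^+ N.+1 * N%:R / N`!%:R * `|G t N|)).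
Proof.
move=> t0; elim: N => [|N IHN].
  rewrite mulr0 !mul0r oppr0; exists (cst 0); first exact: cvg_cst.
  near=> h; have h0 : 0 < h by near: h; exact: nbhs_right_gt.
  rewrite /norm_LC_trunc !big_ord1 !expr0 !(IVP_component0 IVP) ?subrr ?mulr0//.
    exact: ltW.
  by rewrite addr_ge0// ltW.
pose u s := `|G s N.+1|.
have W_slope : upper_right_slope u t (B * N.+1%:R * N%:R * `|G t N|).
  apply: upper_right_slope_le (upper_right_slope_norm _ _ _ _ (L0_contraction N)
    (IVP_equation IVP (ltn0Sn N) t0)).
  apply: W_op_norm_le; first by rewrite !mulr_ge0.
  by move=> x; exact: operator_norm_le.
have w_ge0 s : 0 <= s -> 0 <= rho B C s ^+ N.+1 / N.+1`!%:R.
  by move=> s0; rewrite divr_ge0// exprn_ge0// rho_ge0.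
have := upper_right_slopeD _ _ _ _ _ IHN
  (upper_right_slopeM _ _ _ _ _ (ltW t0) w_ge0
    (is_derive_rho_weight B0 C0 N _ (ltW t0)) W_slope).
rewrite (_ : (fun s => norm_LC_trunc _ _ N + _) =
   (fun s => norm_LC_trunc (rho B C s) (G s) N.+1)); last first.
  by apply/funext => s; rewrite [RHS]/norm_LC_trunc big_ord_recr.
(* The two slopes are in fact equal: the terms with [|G t N|] cancel, and [1 / N!] is
   [(N + 1) / (N + 1)!]. *)
apply: upper_right_slope_le; rewrite le_eqVlt; apply/orP; left; apply/eqP.
rewrite /u factS natrM !exprS.
move: (rho B C t) (`|G t N|) (`|G t N.+1|) => r a b.
field.
by rewrite nat1r !pnatr_eq0 -lt0n fact_gt0.
Unshelve. all: by end_near. Qed.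

Lemma IVP_continuous_pos n t : 0 < t -> {for t, continuous (fun s => G s n)}.
Proof.
case: n => [|n] t0.
  apply: cvg_near_cst; near=> s.
  by rewrite !(IVP_component0 IVP)// ?ltW//; near: s; exact: lt_nbhsr.
exact: is_derive_continuous (IVP_equation IVP (ltn0Sn n) t0).
Unshelve. all: by end_near. Qed.

Lemma norm_LC_trunc_le N t : 0 <= t ->
  norm_LC_trunc (rho B C t) (G t) N <= norm_LC_trunc C G0 N.
Proof.
move=> t0.
have rho0 : rho B C 0 = C by rewrite /rho mulr0 addr0 divr1.
have -> : norm_LC_trunc C G0 N = norm_LC_trunc (rho B C 0) (G 0) N.
  by rewrite rho0; apply: eq_bigr => n _; rewrite (IVP_initial IVP).
(* Stated for any filter, to serve both the right limit at 0 and continuity at positive times. *)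
have cvg_trunc (F : set_system R) (FF : Filter F) (a : R) : 0 <= a ->
    s @[s --> F] --> a -> (forall n, G s n @[s --> F] --> G a n) ->
    norm_LC_trunc (rho B C s) (G s) N @[s --> F] -->
      norm_LC_trunc (rho B C a) (G a) N.
  move=> a0 Fa FG; apply: cvg_big => [|n _]; first exact: add_continuous.
  apply: cvgM; last by apply: cvg_norm; exact: FG.
  apply: cvgM; last exact: cvg_cst.
  have rc := is_derive_continuous _ _ _ (is_derive_rho B0 C0 _ a0).
  have rF : rho B C s @[s --> F] --> rho B C a by exact: cvg_comp Fa rc.
  exact: cvg_comp rF (@exprn_continuous R n _).
apply: (ler_upper_right_slope (fun s => norm_LC_trunc (rho B C s) (G s) N)) => //.
- apply: cvg_trunc => //; first exact: cvg_at_right_filter.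
  by move=> n; rewrite (IVP_initial IVP); exact: (IVP_continuous IVP).
- move=> s s0; apply: cvg_trunc => //; first exact: ltW.
  by move=> n; exact: IVP_continuous_pos.
- move=> s s0; eexists; last exact: upper_right_slope_norm_LC_trunc.
  by rewrite oppr_le0 !mulr_ge0// exprn_ge0// rho_ge0// ltW.
Qed.

(** Each nonempty partial sum is a truncated norm, bounded by the truncated initial norm and hence
    by the full one. *)
Lemma norm_LC_le t : 0 <= t -> (norm_LC (rho B C t) (G t) <= norm_LC C G0)%E.
Proof.
move=> t0; have r0 := rho_ge0 B0 C0 _ t0.
apply: lime_le.
  apply: is_cvg_nneseries => n _ _.
  by rewrite lee_fin mulr_ge0// divr_ge0// exprn_ge0.
apply: nearW => n.
apply: (@le_trans _ _ (\sum_(0 <= k < n) (C ^+ k / k`!%:R * `|G0 k|)%:E)%E).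
  rewrite !sumEFin lee_fin !big_mkord.
  by case: n => [|n]; [rewrite !big_ord0|exact: norm_LC_trunc_le].
apply: nneseries_lim_ge => k _ _.
by rewrite lee_fin mulr_ge0// divr_ge0// exprn_ge0// ltW.
Qed.

End solution.

(** Once the components of index [n] agree, the [W] terms cancel, and the difference of the
    components [n.+1] solves the homogeneous equation. Its norm cannot increase and starts at 0. *)
Lemma IVP_unique (G0 : component_sequence R d)
    (G G' : R -> component_sequence R d) :
  IVP_solution L0 W G0 G -> IVP_solution L0 W G0 G' ->
  forall t n, 0 <= t -> G' t n = G t n.
Proof.
move=> IVP IVP' t n; elim: n t => [|n IHn] t t0.
  by rewrite (IVP_component0 IVP)// (IVP_component0 IVP').
apply/eqP; rewrite -subr_eq0 -normr_le0.
have -> : 0 = `|G' 0 n.+1 - G 0 n.+1|.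
  by rewrite (IVP_initial IVP) (IVP_initial IVP') subrr normr0.
apply: (ler_upper_right_slope (fun s => `|G' s n.+1 - G s n.+1|)) => //.
- apply: cvg_norm; rewrite (IVP_initial IVP) (IVP_initial IVP').
  apply: cvgB; [exact: (IVP_continuous IVP')|exact: (IVP_continuous IVP)].
- move=> s s0; apply: cvg_norm.
  apply: cvgB; first exact: (IVP_continuous_pos _ _ IVP').
  exact: (IVP_continuous_pos _ _ IVP).
- move=> s s0; exists 0 => //; rewrite -(normr0 (X R d n.+1)).
  apply: upper_right_slope_norm (L0_contraction n) _.
  apply: (is_derive_eq (is_deriveB (IVP_equation IVP' (ltn0Sn n) s0)
    (IVP_equation IVP (ltn0Sn n) s0))).
  rewrite !L0_opS.
  have -> : W_op W (G' s) n.+1 = W_op W (G s) n.+1.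
    case: n IHn => [//|n] IHn; rewrite !W_opSS IHn//; exact: ltW.
  by rewrite addr0 linearB opprD addrACA subrr addr0.
Qed.

End IVP.

(** * Existence, uniqueness and norm bound for the initial value problem *)

Theorem theorem3p5 (R : realType) (d : nat) (B C : R)
  (L0 : forall n, {linear X R d n.+1 -> X R d n.+1})
  (W : forall n, {linear X R d n -> X R d n.+1})
  (G0 : component_sequence R d) :
  (0 < d)%N ->
  (forall n, bounded_operator (L0 n)) ->
  (forall n, contraction_generator (L0 n)) ->
  (forall n f, symmetric_class f -> symmetric_class (L0 n f)) ->
  1 <= B ->
  (forall n, bounded_operator (W n)) ->
  (forall n, (operator_norm (W n) <= (B * n.+1%:R * n%:R)%:E)%E) ->
  (forall n f, symmetric_class f -> symmetric_class (W n f)) ->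
  0 < C ->
  LC C G0 ->
  exists G : R -> component_sequence R d,
    [/\ IVP_solution L0 W G0 G,
        forall t : R, 0 <= t -> LC (rho B C t) (G t),
        forall G' : R -> component_sequence R d,
          IVP_solution L0 W G0 G' ->
          (forall t : R, 0 <= t -> LC (rho B C t) (G' t)) ->
          forall (t : R) (n : nat), 0 <= t -> G' t n = G t n &
        forall t : R, 0 <= t -> (norm_LC (rho B C t) (G t) <= norm_LC C G0)%E].
Proof.
move=> _ L0b L0c L0s B1 Wb Wle Ws C0 [G0s G0C].
have B0 : 0 <= B by apply: le_trans B1.
have IVP : IVP_solution L0 W G0 (evolution L0 W G0).
  split=> [n|n|t t0|n t _ _].
  - exact: evolutionE0.
  (* The series is differentiable at every real time, in particular at 0, so it is continuous
     there. *)
  - rewrite -[G0 n](evolutionE0 L0 W); apply: cvg_at_right_filter.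
    exact: is_derive_continuous
      (is_derive_evolution L0 W L0b Wb L0s Ws G0 0 n G0s).
  - exact: evolution_component0.
  - exact: is_derive_evolution.
have le_norm t : 0 <= t ->
    (norm_LC (rho B C t) (evolution L0 W G0 t) <= norm_LC C G0)%E.
  exact: (norm_LC_le L0 W B0 C0 L0c Wle G0 _ IVP).
exists (evolution L0 W G0); split=> // [t t0|G' IVP' _ t n t0].
  split=> [n|]; last exact: le_lt_trans (le_norm t t0) G0C.
  exact: (evolution_series L0 W L0b Wb L0s Ws G0 t n G0s).2.
exact: (IVP_unique L0 W L0c G0 _ _ IVP IVP').
Qed.
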